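(* Let $u(n)$ denote the maximal number of edges in a unit distance graph with $n$ vertices. Then $u(n)=O(n^{4/3})$. More specifically, for all large enough $n$, $$u(n)\le \sqrt[3]{\tfrac{2}{3}\left(2+\sqrt{3}\right)\cdot 29}\cdot n^{4/3}.$$
   Context: A (simple) graph is a unit distance graph if its vertices can be represented by distinct points in the Euclidean plane so that any two vertices connected by an edge are represented by points at distance $1$ (non-adjacent vertices may also be at distance $1$). *)

(* Defs.v *)
From HB Require Import structures.
From mathcomp Require Import all_boot all_order all_algebra.
From mathcomp Require Import all_classical all_reals all_analysis.

Set Implicit Arguments.
Unset Strict Implicit.
Unset Printing Implicit Defensive.

Import Order.TTheory GRing.Theory Num.Theory.
Import numFieldNormedType.Exports.

Local Open Scope ring_scope.

(* Not the library norm of p - q: on row vectors that one is the sup norm. *)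
Definition euclidean_dist (R : realType) (p q : 'rV[R]_2) : R :=
  Num.sqrt (\sum_(i < 2) (p 0 i - q 0 i) ^+ 2).

(* A simple graph on the vertex type T is given by its edge set, a set of
   unordered pairs of distinct vertices. *)
Definition simple_graph (T : finType) (E : {set {set T}}) : Prop :=
  forall e : {set T}, e \in E -> #|e| = 2%N.

Definition unit_distance_graph (R : realType) (T : finType)
    (E : {set {set T}}) : Prop :=
  simple_graph E /\
  exists f : T -> 'rV[R]_2, injective f /\
    forall x y : T, [set x; y]%SET \in E -> euclidean_dist (f x) (f y) = 1.

(* Being a unit distance graph and the number of edges are invariant under
   isomorphism, so 'I_n may serve as the vertex set; the maximum is over a
   nonempty family, which contains the edgeless graph. *)
Definition max_unit_distances (R : realType) (n : nat) : nat :=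
  \max_(E : {set {set 'I_n}} | `[< unit_distance_graph R E >]) #|E|.

(* Main.v *)
Require Import Defs.
From HB Require Import structures.
From mathcomp Require Import all_boot all_order all_algebra.
From mathcomp Require Import all_classical all_reals all_analysis.
From mathcomp Require Import ring lra.

Set Implicit Arguments.
Unset Strict Implicit.
Unset Printing Implicit Defensive.

Import Order.TTheory GRing.Theory Num.Theory.
Import numFieldNormedType.Exports.

Local Open Scope ring_scope.

(* Orient every unit distance upwards: it becomes an incidence between a point
   and the upper unit semicircle centered at the other point, so n points give
   at least u - n arcs of upper semicircles between consecutive points.  Two
   upper semicircles cross at most once, hence there are at most n ^ 2 ordered
   crossing pairs of arcs, and no two arcs share both endpoints.  Pairwise
   noncrossing arcs on s points number at most 3 s: of the arcs leaving a point
   to the right discard the top one, and charge each other arc to the leftmost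
   point of the wedge between it and its successor; a point is charged at most
   twice.  So any set of arcs on s points has at least (arcs - 3 s) crossing
   pairs, and keeping each point with probability 1 / k gives
   arcs <= 3 n k + n ^ 2 / k ^ 2, which for the best k is below
   3.94 n ^ (4 / 3) + O(n); the required constant is about 4.16. *)

(** * Strict concavity of the unit semicircle *)

Section Semicircle.

Variable R : realType.
Implicit Types a b s t u v : R.

Definition semi t : R := Num.sqrt (1 - t ^+ 2).

Lemma semi_ge0 t : 0 <= semi t. Proof. exact: sqrtr_ge0. Qed.

Lemma sqr_semi t : `|t| <= 1 -> semi t ^+ 2 = 1 - t ^+ 2.
Proof.
move=> t1; rewrite sqr_sqrtr// subr_ge0 -[leRHS](expr1n _ 2).
by rewrite -[t ^+ 2]real_normK ?num_real// lerXn2r ?nnegrE.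
Qed.

(* The chord joining two points of the circle runs inside the disk. *)
Lemma semi_chord l s v : 0 < l < 1 -> `|s| <= 1 -> `|v| <= 1 -> s < v ->
  l * semi s + (1 - l) * semi v < semi (l * s + (1 - l) * v).
Proof.
move=> /andP[l0 l1] s1 v1 sv.
have := semi_ge0 s; have := semi_ge0 v; have := sqr_semi s1; have := sqr_semi v1.
rewrite [semi (_ + _)]/semi.
move: (semi s) (semi v) => a b b2 a2 b0 a0.
have w0 : 0 <= l * a + (1 - l) * b by apply: addr_ge0; apply: mulr_ge0 => //; lra.
(* Strict Cauchy-Schwarz: [(s, a)] and [(v, b)] are distinct points of the unit circle, so their
   squared distance is positive. *)
have absv : a * b + s * v < 1.
  have d0 : 0 < (v - s) ^+ 2 by rewrite exprn_gt0// subr_gt0.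
  have := sqr_ge0 (a - b); nra.
have : (l * a + (1 - l) * b) ^+ 2 < 1 - (l * s + (1 - l) * v) ^+ 2.
  have -> : (l * a + (1 - l) * b) ^+ 2 =
    l ^+ 2 * a ^+ 2 + (1 - l) ^+ 2 * b ^+ 2 + 2 * l * (1 - l) * (a * b) by ring.
  have -> : (l * s + (1 - l) * v) ^+ 2 =
    l ^+ 2 * s ^+ 2 + (1 - l) ^+ 2 * v ^+ 2 + 2 * l * (1 - l) * (s * v) by ring.
  have : 0 < l * (1 - l) * (1 - (a * b + s * v)).
    by rewrite !mulr_gt0// subr_gt0.
  by rewrite a2 b2; nra.
move=> h; rewrite -(ger0_norm w0) -sqrtr_sqr ltr_sqrt//.
by rewrite (le_lt_trans _ h)// sqr_ge0.
Qed.

(** [t] and [u] split the segment from [s] to [v] with exchanged weights [l] and [1 - l], so the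
    left sides of the two chord bounds add up to [semi s + semi v]. *)
Lemma semi_concave s t u v : `|s| <= 1 -> `|v| <= 1 ->
  s < t -> s < u -> s + v = t + u -> semi s + semi v < semi t + semi u.
Proof.
move=> s1 v1 st su e.
have sv : s < v by lra.
have vs0 : v - s != 0 by rewrite subr_eq0 gt_eqF.
pose l := (v - t) / (v - s).
have l01 : 0 < l < 1.
  by rewrite divr_gt0 ?subr_gt0//= ?ltr_pdivrMr ?subr_gt0//; lra.
have l01' : 0 < 1 - l < 1 by move: l01; lra.
have := ltrD (semi_chord l01 s1 v1 sv) (semi_chord l01' s1 v1 sv).
have -> : l * s + (1 - l) * v = t by rewrite /l; field.
have -> : (1 - l) * s + (1 - (1 - l)) * v = u.
  have -> : u = s + v - t by lra.
  by rewrite /l; field.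
lra.
Qed.

End Semicircle.

(** * Arcs between consecutive points of upper semicircles *)

Section UpperArcs.

Variables (R : realType) (V : finType) (x y : V -> R).
Hypothesis xy_inj : forall u v, x u = x v -> y u = y v -> u = v.
Implicit Types (c d p q u v w : V) (e f g : V * V * V) (s t : R).

Definition dom c t := `|t - x c| <= 1.

Definition upper c t : R := y c + semi (t - x c).

Definition on c v := dom c (x v) && (y v == upper c (x v)).

Lemma dom_between c s s' t : dom c s -> dom c s' -> s <= t -> t <= s' -> dom c t.
Proof. by rewrite /dom !ler_norml; lra. Qed.

(* Two upper unit semicircles meet at most once, the one with the
   rightmost center being above to the right of the meeting point. *)
Lemma upper_lt c d s t : c != d -> x d <= x c -> dom c s -> dom d t -> s < t ->
  upper d s <= upper c s -> upper d t < upper c t.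
Proof.
move=> cd; rewrite le_eqVlt /upper => /orP[/eqP xdc _ _ _|dc cs dt st].
  rewrite !xdc !lerD2r ltrD2r le_eqVlt => /orP[/eqP ydc|//].
  by rewrite (xy_inj xdc ydc) eqxx in cd.
(* Of the four relative abscissas, [s - x c] is least and [t - x d] greatest, so concavity makes
   [upper c - upper d] grow from [s] to [t]. *)
have e : (s - x c) + (t - x d) = (s - x d) + (t - x c) by ring.
have h1 : s - x c < s - x d by lra.
have h2 : s - x c < t - x c by lra.
by have := semi_concave cs dt h1 h2 e; lra.
Qed.

Lemma on_inj c u v : on c u -> on c v -> x u = x v -> u = v.
Proof.
by move=> /andP[_ /eqP yu] /andP[_ /eqP yv] xuv; apply: xy_inj => //; rewrite yu yv xuv.
Qed.

Lemma on_upper c v : on c v -> upper c (x v) = y v.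
Proof. by case/andP=> _ /eqP. Qed.

(* The triple (c, p, q) encodes the arc from p to q of the upper semicircle
   centered at c. *)
Definition ctr e := e.1.1.
Definition lft e := e.1.2.
Definition rgt e := e.2.

Definition is_arc e :=
  [&& on (ctr e) (lft e), on (ctr e) (rgt e), x (lft e) < x (rgt e) &
      [forall v, on (ctr e) v ==> ~~ (x (lft e) < x v < x (rgt e))]].

Definition spans e t := x (lft e) <= t <= x (rgt e).

(** Vacuous over disjoint spans, so such arcs never cross; the weak inequality also lets noncrossing
    arcs touch. *)
Definition arc_le e f := forall t, spans e t -> spans f t ->
  upper (ctr e) t <= upper (ctr f) t.

Definition cross e f := `[< ~ arc_le e f /\ ~ arc_le f e >].

Lemma crossC e f : cross e f = cross f e.
Proof. by rewrite /cross; congr asbool; rewrite propeqE; split=> -[]. Qed.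

Lemma cross_or e f : ~~ cross e f -> arc_le e f \/ arc_le f e.
Proof. by move/asboolPn; rewrite not_andE !not_notE. Qed.

Lemma not_arc_le e f : ~ arc_le e f ->
  exists t, [/\ spans e t, spans f t & upper (ctr f) t < upper (ctr e) t].
Proof.
move=> /existsNP[t /not_implyP[et /not_implyP[ft /negP]]].
by rewrite -ltNge => lt; exists t.
Qed.

Lemma arc_lt e : is_arc e -> x (lft e) < x (rgt e). Proof. by case/and4P. Qed.

Lemma arc_lft e : is_arc e -> on (ctr e) (lft e). Proof. by case/and4P. Qed.

Lemma arc_rgt e : is_arc e -> on (ctr e) (rgt e). Proof. by case/and4P. Qed.

Lemma arc_gap e v : is_arc e -> on (ctr e) v ->
  x (lft e) < x v -> x v < x (rgt e) -> False.
Proof. by case/and4P=> _ _ _ /forallP/(_ v)/implyP h /h; case: (_ < _); case: (_ < _). Qed.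

Lemma arc_dom e t : is_arc e -> spans e t -> dom (ctr e) t.
Proof.
by move=> /and4P[/andP[dl _] /andP[dr _] _ _] /andP[]; apply: dom_between.
Qed.

Lemma spans_lft e : is_arc e -> spans e (x (lft e)).
Proof. by rewrite /spans lexx /= => /arc_lt/ltW. Qed.

Lemma spans_rgt e : is_arc e -> spans e (x (rgt e)).
Proof. by rewrite /spans lexx andbT => /arc_lt/ltW. Qed.

Lemma arc_end e v : is_arc e -> x (lft e) < x v -> x v <= x (rgt e) ->
  y v = upper (ctr e) (x v) -> v = rgt e.
Proof.
move=> ae lv vr yv.
have ov : on (ctr e) v.
  by rewrite /on yv eqxx andbT; apply: arc_dom => //; rewrite /spans (ltW lv).
have := vr; rewrite le_eqVlt => /orP[/eqP|/(arc_gap ae ov lv)//].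
exact: (on_inj ov (arc_rgt ae)).
Qed.

(** Otherwise an end of one arc would lie strictly between the consecutive ends of the other. *)
Lemma arc_eq e f : is_arc e -> is_arc f -> ctr e = ctr f ->
  x (lft e) < x (rgt f) -> x (lft f) < x (rgt e) -> e = f.
Proof.
move=> ae af cef ef fe.
have xl : x (lft e) = x (lft f).
  apply/eqP; rewrite eq_le; apply/andP; split; rewrite leNgt; apply/negP => lt.
    by apply: (arc_gap af _ lt ef); rewrite -cef arc_lft.
  by apply: (arc_gap ae _ lt fe); rewrite cef arc_lft.
have xr : x (rgt e) = x (rgt f).
  apply/eqP; rewrite eq_le; apply/andP; split; rewrite leNgt; apply/negP => lt.
    by apply: (arc_gap ae _ ef lt); rewrite cef arc_rgt.
  by apply: (arc_gap af _ fe lt); rewrite -cef arc_rgt.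
have [le re] := (arc_lft ae, arc_rgt ae); rewrite cef in le re.
move: (on_inj le (arc_lft af) xl) (on_inj re (arc_rgt af) xr) cef.
case: e f {ae af ef fe le re xl xr} => [[? ?] ?] [[? ?] ?].
by rewrite /lft /rgt /ctr /= => -> -> ->.
Qed.

(** Distinct arcs leaving one point have distinct centers, and [upper_lt] applies from the common
    end, where the heights agree. *)
Lemma arc_same_lft e f t : is_arc e -> is_arc f -> e != f -> lft e = lft f ->
  x (ctr e) <= x (ctr f) -> x (lft e) < t -> t <= x (rgt e) ->
  upper (ctr e) t < upper (ctr f) t.
Proof.
move=> ae af ef l cc lt tr.
have cef : ctr f != ctr e.
  apply: contraNneq ef => cef; apply/eqP; apply: arc_eq => //.
  - by rewrite l arc_lt.
  - by rewrite -l arc_lt.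
apply: (upper_lt cef cc _ _ lt).
- by rewrite l; apply/arc_dom/spans_lft.
- by apply: arc_dom => //; rewrite /spans tr ltW.
- by rewrite {2}l !on_upper ?arc_lft// l.
Qed.

Lemma parallel_arcs e f : is_arc e -> is_arc f -> lft e = lft f ->
  rgt e = rgt f -> e = f.
Proof.
move=> ae af l r; apply/eqP; apply/negP => /negP ef.
wlog cc : e f ae af l r ef / x (ctr e) <= x (ctr f).
  move=> H; have [cc|/ltW cc] := leP (x (ctr e)) (x (ctr f)); first exact: (H e f).
  by apply: (H f e) => //; rewrite eq_sym.
have := arc_same_lft ae af ef l cc (arc_lt ae) (lexx _).
by rewrite {2}r !on_upper ?arc_rgt// r ltxx.
Qed.

(** By [arc_same_lft], the abscissa of the center orders the arcs leaving a point from bottom to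
    top. *)
Definition next_arc (A : {set V * V * V}) e f :=
  [/\ f \in A, lft f = lft e, x (ctr e) < x (ctr f) &
    forall g, g \in A -> lft g = lft e -> x (ctr e) < x (ctr g) ->
      x (ctr f) <= x (ctr g)].

(** The apex is excluded and right ends are included, so the right end of the shorter arc always
    lies in the wedge. *)
Definition in_wedge e f v :=
  [&& x (lft e) < x v, x v <= x (rgt e), x v <= x (rgt f),
      upper (ctr e) (x v) <= y v & y v <= upper (ctr f) (x v)].

(** A relation rather than a function, since several points of the wedge may share the least
    abscissa. *)
Definition charged (A : {set V * V * V}) (S : {set V}) e w :=
  exists2 f, next_arc A e f & [/\ w \in S, in_wedge e f w &
    forall v, v \in S -> in_wedge e f v -> x w <= x v].

Section NonCrossing.

Variables (A : {set V * V * V}) (S : {set V}).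
Hypothesis A_arc : forall e, e \in A -> is_arc e.
Hypothesis A_lft : forall e, e \in A -> lft e \in S.
Hypothesis A_rgt : forall e, e \in A -> rgt e \in S.
Hypothesis A_le : forall e f, e \in A -> f \in A -> arc_le e f \/ arc_le f e.

Lemma next_neq e f : next_arc A e f -> e != f.
Proof. by case=> _ _ lt _; apply: contraTneq lt => ->; rewrite ltxx. Qed.

Lemma exists_next e g : g \in A -> lft g = lft e -> x (ctr e) < x (ctr g) ->
  exists f, next_arc A e f.
Proof.
move=> gA gl eg.
pose P f := [&& f \in A, lft f == lft e & x (ctr e) < x (ctr f)].
have Pg : P g by rewrite /P gA gl eqxx.
case: (@arg_minP _ _ _ g P (fun f => x (ctr f)) Pg) => f /and3P[fA /eqP fl ef] fmin.
by exists f; split=> // h hA hl eh; apply: fmin; rewrite /P hA hl eqxx.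
Qed.

Lemma exists_charged e f : e \in A -> next_arc A e f -> exists w, charged A S e w.
Proof.
move=> eA nf; have ef := next_neq nf; have [fA fl lt _] := nf.
have [ae af] := (A_arc eA, A_arc fA).
have [w0 w0S w0w] : exists2 w, w \in S & in_wedge e f w.
  have [le|/ltW le] := leP (x (rgt e)) (x (rgt f)).
    exists (rgt e); rewrite ?A_rgt// /in_wedge arc_lt// lexx le on_upper ?arc_rgt// lexx /=.
    rewrite -(on_upper (arc_rgt ae)); apply/ltW/(arc_same_lft ae af) => //.
    - exact: ltW.
    - exact: arc_lt.
  exists (rgt f); rewrite ?A_rgt// /in_wedge -fl arc_lt// lexx le.
  rewrite (on_upper (arc_rgt af)) lexx /= andbT.
  rewrite -(on_upper (arc_rgt af)); apply/ltW/(arc_same_lft ae af) => //.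
  - exact: ltW.
  - by rewrite -fl arc_lt.
pose P v := (v \in S) && in_wedge e f v.
have P0 : P w0 by rewrite /P w0S.
case: (@arg_minP _ _ _ w0 P x P0) => w /andP[wS ww] wmin.
by exists w, f => //; split=> // v vS vw; apply: wmin; rewrite /P vS.
Qed.

(* Just left of w, an arc charging w of the same kind would run inside the
   wedge of the other one; followed to the left it would have to start in the
   wedge, at its apex, or to pass through the apex. *)
Lemma charged_inj e1 e2 w : e1 \in A -> e2 \in A ->
  charged A S e1 w -> charged A S e2 w -> (w == rgt e1) = (w == rgt e2) ->
  e1 = e2.
Proof.
move=> e1A e2A ch1 ch2 wr; apply/eqP; apply/negP => /negP e12.
wlog le12 : e1 e2 e1A e2A ch1 ch2 wr e12 / arc_le e1 e2.
  move=> H; have [le|le] := A_le e1A e2A; first exact: (H e1 e2).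
  by apply: (H e2 e1) => //; rewrite eq_sym.
have [f1 n1 [wS /and5P[l1w wr1 wf1 e1w wf1y] wmin]] := ch1.
have [f2 n2 [_ /and5P[l2w wr2 wf2 e2w wf2y] _]] := ch2.
have [f1A f1l lt1 f1min] := n1.
have [[ae1 ae2] af1] := (A_arc e1A, A_arc e2A, A_arc f1A).
have ne1f1 := next_neq n1.
(* The two kinds of charge: [w] ends the arc, or lies strictly above it because no point is interior
   to an arc. *)
have strict2 : w != rgt e2 -> upper (ctr e2) (x w) < y w.
  move=> ne; rewrite lt_neqAle e2w andbT; apply: contra_neq ne => e.
  exact: arc_end.
have s1 : spans e1 (x w) by rewrite /spans (ltW l1w).
have s2 : spans e2 (x w) by rewrite /spans (ltW l2w).
have sf : spans f1 (x w) by rewrite /spans f1l (ltW l1w).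
have not_rgt_f1 : w = rgt f1 -> w != rgt e1.
  move=> wf; apply: contra_neq ne1f1 => we.
  by apply: parallel_arcs; rewrite ?f1l// -wf -we.
have e2f1 : e2 != f1.
  apply/eqP => e; case: (boolP (w == rgt e2)) => [/eqP w2|/strict2 lt].
    by have := not_rgt_f1; rewrite -e -w2 wr w2 eqxx => /(_ erefl).
  by move: lt; rewrite e ltNge wf1y.
have le2f : arc_le e2 f1.
  case: (A_le e2A f1A) => // /(_ _ sf s2) f1e2.
  case: (boolP (w == rgt e2)) => [w2|/strict2 lt]; last by move: lt; rewrite ltNge (le_trans wf1y).
  have e2y : upper (ctr e2) (x w) = y w by rewrite (eqP w2) on_upper ?arc_rgt.
  have wf : w = rgt f1.
    by apply: arc_end; rewrite ?f1l//; apply/eqP; rewrite eq_le wf1y -e2y.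
  by move: (not_rgt_f1 wf); rewrite wr w2.
(* [e2] now runs between [e1] and [f1]. The cases contradict in turn the choice of [w] as leftmost,
   the absence of points inside [e2], and the choice of [f1] as successor of [e1]. *)
have [lt|lt|exl] := ltgtP (x (lft e1)) (x (lft e2)).
- have s : spans e1 (x (lft e2)) by rewrite /spans (ltW lt) (le_trans (ltW l2w)).
  have s' : spans f1 (x (lft e2)) by rewrite /spans f1l (ltW lt) (le_trans (ltW l2w)).
  have /(wmin _ (A_lft e2A)) : in_wedge e1 f1 (lft e2).
    rewrite /in_wedge lt (andP s).2 (andP s').2 /=.
    by rewrite -(on_upper (arc_lft ae2)) le12 ?le2f ?spans_lft.
  by rewrite leNgt l2w.
- have s : spans e2 (x (lft e1)) by rewrite /spans (ltW lt) (le_trans (ltW l1w)).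
  have s' : spans f1 (x (lft e1)) by rewrite -f1l spans_lft.
  have yp : y (lft e1) = upper (ctr e2) (x (lft e1)).
    apply/eqP; rewrite eq_le -{1}(on_upper (arc_lft ae1)) le12 ?spans_lft//=.
    by rewrite (le_trans (le2f _ s s'))// -f1l on_upper ?arc_lft.
  have := arc_end ae2 lt (andP s).2 yp => pr.
  by have := lt_le_trans l1w wr2; rewrite pr ltxx.
- have l : lft e1 = lft e2.
    have s : spans e1 (x (lft e2)) by rewrite -exl spans_lft.
    have s' : spans f1 (x (lft e2)) by rewrite -exl -f1l spans_lft.
    have y1 : upper (ctr e1) (x (lft e2)) = y (lft e1) by rewrite -exl on_upper ?arc_lft.
    have yf : upper (ctr f1) (x (lft e2)) = y (lft e1) by rewrite -exl -f1l on_upper ?arc_lft.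
    have y2 := on_upper (arc_lft ae2); have s2l := spans_lft ae2.
    apply: xy_inj => //; apply/eqP; rewrite eq_le.
    by rewrite -{1}y1 -y2 -yf le12 ?le2f.
  have lt12 : x (ctr e1) < x (ctr e2).
    rewrite ltNge; apply/negP => le21.
    have := arc_same_lft ae2 ae1 _ (esym l) le21 l2w wr2.
    by rewrite eq_sym e12 => /(_ isT); rewrite ltNge le12.
  have := f1min _ e2A (esym l) lt12 => lef2.
  have := arc_same_lft af1 ae2 _ _ lef2 _ wf1.
  by rewrite eq_sym e2f1 f1l l => /(_ isT erefl l2w); rewrite ltNge le2f.
Qed.

Lemma card_noncrossing : (#|A| <= 3 * #|S|)%N.
Proof.
pose B := [set e in A | `[< exists f, next_arc A e f >]]%SET.
have BA : B \subset A by apply/fintype.subsetP => e; rewrite inE => /andP[].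
(* Arcs without a successor: at most one per left end. *)
have top : (#|A :\: B| <= #|S|)%N.
  rewrite -(@card_in_imset _ _ lft).
    apply/subset_leq_card/fintype.subsetP => _ /imsetP[e + ->].
    by rewrite inE => /andP[_ /A_lft].
  move=> e f; rewrite !inE negb_and => /andP[+ eA] /andP[+ fA] l.
  rewrite eA fA /= => /asboolPn ne /asboolPn nf.
  apply/eqP; apply/negP => /negP ef; have [ae af] := (A_arc eA, A_arc fA).
  have [lt|lt|c] := ltgtP (x (ctr e)) (x (ctr f)).
  - by apply: ne; apply: (@exists_next _ f).
  - by apply: nf; apply: (@exists_next _ e).
  (* Centers of equal abscissa: each arc would be strictly above the other where the shorter one
     ends. *)
  - wlog ltr : e f eA fA l ne nf ef ae af c / x (rgt e) <= x (rgt f).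
      move=> H; have [h|/ltW h] := leP (x (rgt e)) (x (rgt f)); first exact: (H e f).
      by apply: (H f e) => //; rewrite eq_sym.
    have h1 := arc_same_lft ae af ef l.
    have h2 := arc_same_lft af ae _ (esym l).
    have := h1 _ _ (arc_lt ae) (lexx _); rewrite c lexx => /(_ isT).
    rewrite ltNge ltW// h2 ?c// 1?eq_sym// -l arc_lt//.
have [w wP] : {w : V * V * V -> V | forall e, e \in B -> charged A S e (w e)}.
  have H e : exists v, e \in B -> charged A S e v.
    case: (boolP (e \in B)) => [|_]; last by exists (ctr e).
    by rewrite inE => /andP[eA /asboolP[f /(exists_charged eA)[v cv]]]; exists v.
  by exists (fun e => projT1 (cid (H e))) => e; case: cid.
(* The boolean records the kind of charge, so that [charged_inj] makes the pair injective. *)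
have inner : (#|B| <= #|S| * 2)%N.
  rewrite -card_bool -(cardsT bool) -cardsX.
  rewrite -(@card_in_imset _ _ (fun e => (w e, w e == rgt e)) B).
    apply/subset_leq_card/fintype.subsetP => _ /imsetP[e eB ->].
    by rewrite !inE andbT; have [f _ []] := wP _ eB.
  move=> e f eB fB [we wr]; have [ce cf] := (wP _ eB, wP _ fB).
  rewrite -we in cf wr; apply: charged_inj ce cf wr; exact: (fintype.subsetP BA).
rewrite -(cardsID B A) (finset.setIidPr BA) addnC mulSn leq_add// mulnC.
exact: inner.
Qed.

End NonCrossing.

(** Arcs crossing no other arc of [A] are pairwise noncrossing; every other arc is the first
    component of some crossing pair. *)
Lemma card_le_crossings (A : {set V * V * V}) (S : {set V}) :
  {in A, forall e, [/\ is_arc e, lft e \in S & rgt e \in S]} ->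
  (#|A| <= 3 * #|S| + #|[set ef in finset.setX A A | cross ef.1 ef.2]%SET|)%N.
Proof.
move=> HA; set X := [set ef in _ | _]%SET.
pose B := [set e in A | ~~ [exists f in A, cross e f]]%SET.
have BA : B \subset A by apply/fintype.subsetP => e; rewrite inE => /andP[].
rewrite -(cardsID B A) (finset.setIidPr BA) leq_add//.
  apply: card_noncrossing => [e|e|e|e f].
  - by move/(fintype.subsetP BA)/HA => [].
  - by move/(fintype.subsetP BA)/HA => [].
  - by move/(fintype.subsetP BA)/HA => [].
  - rewrite !inE => /andP[_ /existsPn ne] /andP[fA _].
    by apply: cross_or; have := ne f; rewrite fA.
apply: leq_trans (leq_imset_card fst X); apply/subset_leq_card/fintype.subsetP => e.
rewrite !inE => /andP[+ eA]; rewrite eA negbK => /existsP[f /andP[fA ef]].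
by apply/imsetP; exists (e, f); rewrite // !inE /= eA fA ef.
Qed.

(** * Counting crossing pairs of arcs *)

Lemma cross_ctr e f : cross e f -> ctr e != ctr f.
Proof. by move/asboolP=> [ef _]; apply/eqP => c; apply: ef => t _ _; rewrite c. Qed.

Lemma cross_once e f e' f' : is_arc e -> is_arc f -> is_arc e' -> is_arc f' ->
  cross e f -> cross e' f' -> ctr e = ctr e' -> ctr f = ctr f' ->
  e = e' /\ f = f'.
Proof.
wlog fe : e f e' f' / x (ctr f) <= x (ctr e).
  move=> H ae af ae' af' ef ef' ce cf.
  have [fe|/ltW fe] := leP (x (ctr f)) (x (ctr e)); first exact: (H e f e' f').
  by rewrite crossC in ef; rewrite crossC in ef'; case: (H f e f' e').
(* The semicircle of [e], whose center is not to the left, stays above once it is above. A crossing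
   has it above somewhere and below somewhere, so one crossing cannot precede another. *)
have ordered e1 f1 e2 f2 : is_arc e1 -> is_arc f2 -> cross e1 f1 ->
    cross e2 f2 -> ctr e = ctr e1 -> ctr f = ctr f1 -> ctr e = ctr e2 -> ctr f = ctr f2 ->
    ~ (forall t t', spans e1 t -> spans f1 t -> spans e2 t' -> spans f2 t' -> t <= t').
  move=> a1 a2 c1 c2 ce1 cf1 ce2 cf2 before.
  have [/not_arc_le[s [es fs lt]] _] := asboolP _ c1.
  have [_ /not_arc_le[t [ft et lt']]] := asboolP _ c2; move: lt'; rewrite ltNge => /negP; apply.
  have := before _ _ es fs et ft; rewrite le_eqVlt => /orP[/eqP <-|st].
    by rewrite -ce2 -cf2 ce1 cf1 ltW.
  have ne := cross_ctr c1; rewrite -ce1 -cf1 in ne lt.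
  rewrite -ce2 -cf2; apply/ltW/(upper_lt ne fe _ _ st); last exact: ltW.
    by rewrite ce1; apply: arc_dom.
  by rewrite cf2; apply: arc_dom.
move=> ae af ae' af' ef ef' ce cf; split; apply: arc_eq => //; rewrite ltNge; apply/negP => le.
- apply: (ordered e' f' e f) => // s t /andP[_ se] _ /andP[et _] _.
  exact: le_trans se (le_trans le et).
- apply: (ordered e f e' f') => // s t /andP[_ se] _ /andP[et _] _.
  exact: le_trans se (le_trans le et).
- apply: (ordered e' f' e f) => // s t _ /andP[_ se] _ /andP[et _].
  exact: le_trans se (le_trans le et).
- apply: (ordered e f e' f') => // s t _ /andP[_ se] _ /andP[et _].
  exact: le_trans se (le_trans le et).
Qed.

(** This and the next two lemmas give a crossing pair four distinct ends, hence survival probability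
    [k ^ -4] under sampling. *)
Lemma cross_lft e f : is_arc e -> is_arc f -> cross e f -> lft e != lft f.
Proof.
wlog ef : e f / x (ctr e) <= x (ctr f).
  move=> H ae af c; have [le|/ltW le] := leP (x (ctr e)) (x (ctr f)); first exact: H.
  by rewrite eq_sym; apply: H; rewrite 1?crossC.
move=> ae af c; apply/eqP => l; have [/not_arc_le[t [et ft lt']] _] := asboolP _ c; move: lt'.
rewrite ltNge => /negP; apply; move: (et) => /andP[+ tr].
rewrite le_eqVlt => /orP[/eqP <-|lt].
  by rewrite {2}l !on_upper ?arc_lft// l.
apply/ltW/arc_same_lft => //; apply: contraNneq (cross_ctr c) => ->//.
Qed.

Lemma cross_rgt e f : is_arc e -> is_arc f -> cross e f -> rgt e != rgt f.
Proof.
wlog ef : e f / x (ctr e) <= x (ctr f).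
  move=> H ae af c; have [le|/ltW le] := leP (x (ctr e)) (x (ctr f)); first exact: H.
  by rewrite eq_sym; apply: H; rewrite 1?crossC.
move=> ae af c; apply/eqP => r; have [_ /not_arc_le[t [ft et lt]]] := asboolP _ c.
have ye := on_upper (arc_rgt ae); have yf := on_upper (arc_rgt af).
move: (et) => /andP[_]; rewrite le_eqVlt => /orP[/eqP tr|tr].
  by move: lt; rewrite tr ye r yf ltxx.
have ne := cross_ctr c; rewrite eq_sym in ne.
have := upper_lt ne ef (arc_dom af ft) (arc_dom ae (spans_rgt ae)) tr (ltW lt).
by rewrite ye r yf ltxx.
Qed.

Lemma cross_rgt_lft e f : is_arc e -> is_arc f -> cross e f -> rgt e != lft f.
Proof.
move=> ae af c; apply/eqP => r; have [/not_arc_le[t [et ft lt']] _] := asboolP _ c; move: lt'.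
have tr : t = x (rgt e).
  by apply/eqP; rewrite eq_le (andP et).2 r (andP ft).1.
have ye := on_upper (arc_rgt ae); have yf := on_upper (arc_lft af).
by rewrite tr ye r yf ltxx.
Qed.

Definition arcs := [set e | is_arc e]%SET.

Definition crossings := [set ef in finset.setX arcs arcs | cross ef.1 ef.2]%SET.

Lemma card_crossings : (#|crossings| <= #|V| ^ 2)%N.
Proof.
rewrite -(@card_in_imset _ _ (fun ef => (ctr ef.1, ctr ef.2))).
  by rewrite expnS expn1 -card_prod max_card.
move=> [e f] [e' f']; rewrite !inE /= => /andP[/andP[ae af] c] /andP[/andP[ae' af'] c'] [ce cf].
by have [-> ->] := cross_once ae af ae' af' c c' ce cf.
Qed.

Definition ends e := [set lft e; rgt e]%SET.

Lemma card_ends e : e \in arcs -> #|ends e| = 2%N.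
Proof.
rewrite inE => /arc_lt lt; rewrite cards2; case: eqP => // l.
by rewrite l ltxx in lt.
Qed.

Lemma card_ends_crossing ef : ef \in crossings -> #|ends ef.1 :|: ends ef.2| = 4%N.
Proof.
case: ef => e f; rewrite !inE /= => /andP[/andP[ae af] c].
have [d1 d2 d3] := And3 (cross_lft ae af c) (cross_rgt ae af c) (cross_rgt_lft ae af c).
have d4 : rgt f != lft e by apply: cross_rgt_lft => //; rewrite crossC.
rewrite cardsU !card_ends ?inE// (_ : _ :&: _ = finset.set0) ?cards0//.
apply/setP => v; rewrite !inE; apply/negP => /andP[/orP[]/eqP-> /orP[]]; apply/negP => //.
by rewrite eq_sym.
Qed.

(** Each point of a semicircle except the last starts an arc, and there are at most [#|V|] last
    points. *)
Lemma card_incidences :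
  (#|[set cv | on cv.1 cv.2]%SET| <= #|arcs| + #|V|)%N.
Proof.
set P := [set _ | _]%SET.
pose L := [set (e.1 : V * V) | e in arcs]%SET.
rewrite -(cardsID L P) leq_add//.
  by apply: leq_trans (leq_imset_card _ _); apply/subset_leq_card/finset.subsetIr.
rewrite -(@card_in_imset _ _ fst) ?max_card//.
have last c v v' : (c, v) \notin L -> on c v -> on c v' -> x v' <= x v.
  move=> nL ov ov'; rewrite leNgt; apply/negP => lt; move/negP: nL; apply.
  pose Q w := on c w && (x v < x w).
  have Qv' : Q v' by rewrite /Q ov'.
  case: (@arg_minP _ _ _ v' Q x Qv') => w /andP[ow vw] wmin.
  apply/imsetP; exists (c, v, w); rewrite // inE; apply/and4P; split=> //.
  apply/forallP => u; apply/implyP => ou; apply/negP => /andP[vu].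
  by rewrite ltNge wmin// /Q /lft /= ou.
move=> [c v] [c' v'] /[!inE] /= /andP[nL ov] /andP[nL' ov'] cc; rewrite -cc in nL' ov' *.
congr pair; apply: (on_inj ov ov'); apply/eqP; rewrite eq_le.
by rewrite (last _ _ _ nL ov ov') (last _ _ _ nL' ov' ov).
Qed.

End UpperArcs.

(** * Random sampling of the points, by counting functions *)

Section Sampling.

Variables (V : finType) (k : nat).

(** A uniformly random [h] keeps each point independently with probability [1 / k.+1]. *)
Definition zeros (h : {ffun V -> 'I_k.+1}) := [set v | h v == ord0]%SET.

Lemma card_zeros (B : {set V}) :
  (#|[set h | B \subset zeros h]%SET| * k.+1 ^ #|B| = k.+1 ^ #|V|)%N.
Proof.
rewrite -(cardsC B) [in RHS]addnC expnD; congr muln.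
rewrite -[in RHS](card_ord k.+1) -(card_pffun_on ord0).
apply: eq_card => h; rewrite inE.
apply/fintype.subsetP/pffun_onP => [sub|[/fintype.subsetP sub _] v vB].
  split=> //; apply/fintype.subsetP => v; rewrite !inE; apply: contra => /sub.
  by rewrite inE.
rewrite inE; apply/negPn/negP => hv; have := sub v.
by rewrite !inE hv vB => /(_ isT).
Qed.

(** Expected number of surviving [B i], with denominators cleared: exchange the sums over [h] and
    [i]. *)
Lemma sum_card_zeros (I : finType) (B : I -> {set V}) (D : {set I}) (j : nat) :
  {in D, forall i, #|B i| = j} ->
  ((\sum_h #|[set i in D | B i \subset zeros h]%SET|) * k.+1 ^ j =
   #|D| * k.+1 ^ #|V|)%N.
Proof.
move=> Bj.
under eq_bigr => h _ do rewrite -sum1_card.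
under eq_bigr => h _ do under eq_bigl => i do rewrite inE.
rewrite (exchange_big_dep (mem D)) /=; last by move=> ? ? _ /andP[].
rewrite big_distrl -sum_nat_const; apply: eq_bigr => i iD.
rewrite -(card_zeros (B i)) Bj//; congr muln; rewrite -sum1_card.
by apply: eq_bigl => h; rewrite inE iD.
Qed.

End Sampling.

Lemma card_arcs (R : realType) (V : finType) (x y : V -> R) (k : nat) :
  (forall u v, x u = x v -> y u = y v -> u = v) -> (0 < k)%N ->
  (#|arcs x y| * k ^ 2 <= 3 * #|V| * k ^ 3 + #|V| ^ 2)%N.
Proof.
move=> xy_inj; case: k => // k _.
pose S (h : {ffun V -> 'I_k.+1}) := zeros h.
(* Arcs stay those of the full configuration; one survives when both its ends do. *)
pose A h := [set e in arcs x y | ends e \subset S h]%SET.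
pose X h := [set ef in crossings x y | ends ef.1 :|: ends ef.2 \subset S h]%SET.
have step h : (#|A h| <= 3 * #|S h| + #|X h|)%N.
  apply: leq_trans (card_le_crossings xy_inj (S := S h) _) _.
    by move=> e; rewrite !inE finset.subUset !finset.sub1set !inE => /and3P[]; split.
  rewrite leq_add2l; apply/subset_leq_card/fintype.subsetP => -[e f].
  by rewrite !inE !finset.subUset /= => /andP[/andP[/andP[-> ->] /andP[-> ->]] ->].
have sA := sum_card_zeros k (@card_ends R V x y).
have sX := sum_card_zeros k (card_ends_crossing xy_inj).
have sS : ((\sum_h #|S h|) * k.+1 = #|V| * k.+1 ^ #|V|)%N.
  have := sum_card_zeros k (fun v (_ : v \in [set: V]%SET) => cards1 v).
  rewrite cardsT expn1 => <-; congr muln; apply: eq_bigr => h _.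
  by apply: eq_card => v; rewrite !inE finset.sub1set inE.
have : (\sum_h #|A h| <= 3 * \sum_h #|S h| + \sum_h #|X h|)%N.
  by rewrite big_distrr -big_split /=; apply: leq_sum => h _.
(* Points, arcs and crossings survive with exponents 1, 2 and 4; the largest clears all
   denominators. *)
rewrite -(@leq_pmul2r (k.+1 ^ 4)) ?expn_gt0// mulnDl sX.
have -> : (k.+1 ^ 4 = k.+1 ^ 2 * k.+1 ^ 2)%N by rewrite -expnD.
rewrite mulnA sA -expnD.
have -> : (3 * (\sum_h #|S h|) * k.+1 ^ (2 + 2) = 3 * #|V| * k.+1 ^ #|V| * k.+1 ^ 3)%N.
  by transitivity (3 * ((\sum_h #|S h|) * k.+1) * k.+1 ^ 3)%N; [ring | rewrite sS; ring].
have -> : (#|arcs x y| * k.+1 ^ #|V| * k.+1 ^ 2 = #|arcs x y| * k.+1 ^ 2 * k.+1 ^ #|V|)%N by ring.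
have -> : (3 * #|V| * k.+1 ^ #|V| * k.+1 ^ 3 = 3 * #|V| * k.+1 ^ 3 * k.+1 ^ #|V|)%N by ring.
rewrite -mulnDl leq_pmul2r ?expn_gt0// => /leq_trans; apply.
by rewrite leq_add2l card_crossings.
Qed.

(** * From unit distances to incidences, and the final constants *)

Lemma on_dist (R : realType) (T : finType) (f : T -> 'rV[R]_2) (c v : T) :
  euclidean_dist (f c) (f v) = 1 -> f c 0 1 <= f v 0 1 ->
  on (fun u => f u 0 0) (fun u => f u 0 1) c v.
Proof.
rewrite /euclidean_dist big_ord_recl big_ord1 (_ : lift ord0 ord0 = 1); last exact/val_inj.
move=> d1 le.
have e : (f c 0 0 - f v 0 0) ^+ 2 + (f c 0 1 - f v 0 1) ^+ 2 = 1.
  have := sqr_sqrtr (addr_ge0 (sqr_ge0 (f c 0 0 - f v 0 0)) (sqr_ge0 (f c 0 1 - f v 0 1))).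
  by rewrite d1 expr1n => <-.
rewrite /on /dom /upper /semi; apply/andP; split.
  rewrite -(@ler_pXn2r _ 2) ?nnegrE// expr1n real_normK ?num_real//.
  have := sqr_ge0 (f c 0 1 - f v 0 1); lra.
have -> : 1 - (f v 0 0 - f c 0 0) ^+ 2 = (f v 0 1 - f c 0 1) ^+ 2 by rewrite -e; ring.
by rewrite sqrtr_sqr ger0_norm ?subr_ge0// subrKC.
Qed.

Lemma card_unit_distance_graph (R : realType) (T : finType) (E : {set {set T}}) (k : nat) :
  unit_distance_graph R E -> (0 < k)%N ->
  (#|E| * k ^ 2 <= 3 * #|T| * k ^ 3 + #|T| ^ 2 + #|T| * k ^ 2)%N.
Proof.
move=> [sE [f [f_inj fE]]] k0.
pose x u := f u 0 0; pose y u := f u 0 1.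
have xy_inj u v : x u = x v -> y u = y v -> u = v.
  move=> xuv yuv; apply/f_inj/rowP => -[[|[|//]] i2].
    by rewrite (_ : Ordinal i2 = 0) //; apply: val_inj.
  by rewrite (_ : Ordinal i2 = 1) //; apply: val_inj.
(* Each edge comes from an incidence of its upper end with the semicircle around its lower end. *)
have EP : (#|E| <= #|[set cv | on x y cv.1 cv.2]%SET|)%N.
  rewrite (leq_trans _ (leq_imset_card (fun cv : T * T => [set cv.1; cv.2]%SET) _))//.
  apply/subset_leq_card/fintype.subsetP => e eE; apply/imsetP.
  have /eqP/cards2P[a [b [ab eab]]] := sE e eE; rewrite eab in eE *.
  have [le|/ltW le] := leP (y a) (y b).
    by exists (a, b); rewrite // inE /=; apply: on_dist => //; apply: fE.
  exists (b, a); last by rewrite /= finset.setUC.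
  by rewrite inE /=; apply: on_dist => //; apply: fE; rewrite finset.setUC.
have := card_arcs xy_inj k0; have := leq_trans EP (card_incidences xy_inj).
rewrite -(@leq_pmul2r (k ^ 2)) ?expn_gt0 ?k0// mulnDl => /leq_trans + h.
by apply; rewrite leq_add2r.
Qed.

Lemma max_unit_distances_le (R : realType) (n k : nat) : (0 < k)%N ->
  (max_unit_distances R n * k ^ 2 <= 3 * n * k ^ 3 + n ^ 2 + n * k ^ 2)%N.
Proof.
move=> k0; rewrite -leq_divRL ?expn_gt0 ?k0//.
apply/bigmax_leqP => E /asboolP uE; rewrite leq_divRL ?expn_gt0 ?k0//.
by have := card_unit_distance_graph uE k0; rewrite card_ord.
Qed.

(* The minimum over real k > 0 of 3 n k + n ^ 2 / k ^ 2 is at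
   k = (2 / 3) ^ (1 / 3) n ^ (1 / 3), close to 9 / 10 n ^ (1 / 3). *)
Lemma max_unit_distances_le41 (R : realType) (n : nat) : (25 ^ 3 <= n)%N ->
  (max_unit_distances R n)%:R <= 41 / 10 * n%:R `^ (4 / 3) :> R.
Proof.
move=> n_ge; pose z : R := n%:R `^ 3^-1.
have z0 : 0 <= z := powR_ge0 _ _.
have z3 : z ^+ 3 = n%:R by rewrite -powR_mulrn// -powRrM mulVf// powRr1.
have -> : n%:R `^ (4 / 3) = z ^+ 4 by rewrite -powR_mulrn// -powRrM mulrC.
have z25 : 25 <= z.
  by rewrite -(@ler_pXn2r _ 3) ?nnegrE// z3 -natrX ler_nat.
pose k := (Num.truncn (9 / 10 * z)).+1.
have /andP[k_le lt_k] : (Num.truncn (9 / 10 * z))%:R <= 9 / 10 * z < k%:R.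
  by apply: truncn_itv; lra.
have {}k_le : k%:R <= 9 / 10 * z + 1 by rewrite /k -natr1 lerD2r.
have := max_unit_distances_le R n (ltn0Sn _ : (0 < k)%N).
rewrite -(ler_nat R) !(natrX, natrD, natrM) -z3.
move: k_le lt_k; move: (max_unit_distances R n)%:R k%:R => u K K_le lt_K h.
have K0 : 0 < K by lra.
have K2 : 81 / 100 * z ^+ 2 <= K ^+ 2.
  have -> : 81 / 100 * z ^+ 2 = (9 / 10 * z) ^+ 2 by field.
  by rewrite ler_pXn2r ?nnegrE ?ltW//; lra.
(* Rounding [k] up costs [3 * z ^+ 3] and the last points [z ^+ 3], together at most
   [4 / 25 * z ^+ 4]; and 27/10 + 100/81 + 4/25 < 41/10. *)
have z4 : 25 * z ^+ 3 <= z ^+ 4 by rewrite [leRHS]exprS ler_pM2r ?exprn_gt0//; lra.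
have h1 : z ^+ 6 <= 100 / 81 * z ^+ 4 * K ^+ 2.
  have -> : z ^+ 6 = 100 / 81 * z ^+ 4 * (81 / 100 * z ^+ 2) by field.
  by rewrite ler_wpM2l// mulr_ge0// exprn_ge0.
have h2 : 3 * z ^+ 3 * K <= 27 / 10 * z ^+ 4 + 3 * z ^+ 3.
  have -> : 27 / 10 * z ^+ 4 + 3 * z ^+ 3 = 3 * z ^+ 3 * (9 / 10 * z + 1) by field.
  by rewrite ler_wpM2l// mulr_ge0// exprn_ge0.
have {}h : u * K ^+ 2 <= (3 * z ^+ 3 * K + 100 / 81 * z ^+ 4 + z ^+ 3) * K ^+ 2.
  have -> : (3 * z ^+ 3 * K + 100 / 81 * z ^+ 4 + z ^+ 3) * K ^+ 2 =
    3 * z ^+ 3 * K ^+ 3 + 100 / 81 * z ^+ 4 * K ^+ 2 + z ^+ 3 * K ^+ 2 by ring.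
  apply: le_trans h _; rewrite -exprM; lra.
move: h; rewrite ler_pM2r ?exprn_gt0// => h; have := exprn_ge0 4 z0; lra.
Qed.

Local Open Scope classical_set_scope.

Theorem mainTheorem1 (R : realType) :
  ((fun n : nat => (max_unit_distances R n)%:R : R^o) =O_\oo
     (fun n : nat => (n%:R `^ (4 / 3) : R^o))) /\
  (\forall n \near \oo,
     (max_unit_distances R n)%:R <=
       (2 / 3 * (2 + Num.sqrt 3) * 29) `^ (3^-1) * n%:R `^ (4 / 3) :> R).
Proof.
split.
  apply/eqO_exP; exists (41 / 10); first by rewrite divr_gt0.
  near=> n; rewrite normr_nat (ger0_norm (powR_ge0 _ _)).
  by apply: max_unit_distances_le41; near: n; exact: nbhs_infty_ge.
near=> n; have n_ge : (25 ^ 3 <= n)%N by near: n; exact: nbhs_infty_ge.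
apply: le_trans (max_unit_distances_le41 R n_ge) _.
apply: ler_wpM2r; first exact: powR_ge0.
(* This precision suffices: 2/3 * (2 + 17/10) * 29 > 71, while the cube of 41/10 is below 69. *)
have sqrt3 : (17 / 10 : R) <= Num.sqrt 3.
  by rewrite -(ger0_norm (_ : 0 <= 17 / 10 :> R)) ?divr_ge0// -sqrtr_sqr ler_sqrt//; lra.
have -> : (41 / 10 : R) = ((41 / 10) ^+ 3) `^ 3^-1.
  by rewrite -powR_mulrn ?divr_ge0// -powRrM mulfV// powRr1 ?divr_ge0.
by apply: ge0_ler_powR; rewrite ?invr_ge0 ?nnegrE//; lra.
Unshelve. all: by end_near.
Qed.
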